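(* Let $\theta>0$ and, for $x>0$, let $X(t)=x-N_t$, where $N_t$ is a homogeneous Poisson process with intensity $\theta$ and $N_0=0$. Let $\tau(x)=\inf\{t>0: X(t)\le 0\}$ and $A(x)=\int_0^{\tau(x)}X(t)\,dt$. Then the expected value of the time average of $X$ up to time $\tau(x)$ is $$E\left[\frac{A(x)}{\tau(x)}\right]=E\left[\frac{1}{\tau(x)}\int_0^{\tau(x)}X(t)\,dt\right]=\begin{cases}\dfrac{x+1}{2} & \text{if } x\text{ is a positive integer},\\[2mm] x-\dfrac{[x]}{2} & \text{if } x>0\text{ is not an integer}.\end{cases}$$
   Context: $[x]$ denotes the integer part of $x$. *)

(* Defs.v *)
From HB Require Import structures.
From mathcomp Require Import all_boot all_order all_algebra.
From mathcomp Require Import all_classical all_reals all_analysis.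

Set Implicit Arguments.
Unset Strict Implicit.
Unset Printing Implicit Defensive.

Import Order.TTheory GRing.Theory Num.Theory.
Import numFieldNormedType.Exports.

Local Open Scope classical_set_scope.
Local Open Scope ring_scope.

(* The product rule for subfamilies is obtained by taking A i = setT outside
   of the subfamily. *)
Definition mutually_independent (R : realType) (d d' : measure_display)
    (T : measurableType d) (E : measurableType d') (P : probability T R)
    (n : nat) (Y : 'I_n -> T -> E) : Prop :=
  forall A : 'I_n -> set E, (forall i, measurable (A i)) ->
    (P (\bigcap_(i in [set: 'I_n]) (Y i @^-1` A i)) =
     \prod_(i < n) P (Y i @^-1` A i))%E.

(* The truncated subtraction is the true one for s <= t along nondecreasing
   paths. *)
Definition increment (T : Type) (R : realType) (N : R -> T -> nat)
    (s t : R) : T -> nat :=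
  fun w => (N t w - N s w)%N.

(* Homogeneous Poisson process on [0, +oo[ with intensity theta, as a counting
   process; the values N t for t < 0 are irrelevant. *)
Record poisson_process (R : realType) (d : measure_display)
    (T : measurableType d) (P : probability T R) (theta : R)
    (N : R -> {RV P >-> nat}) : Prop := {
  poisson_process0 : forall w, N 0 w = 0%N ;
  poisson_process_nondecreasing : forall w (s t : R),
    0 <= s -> s <= t -> (N s w <= N t w)%N ;
  poisson_process_right_continuous : forall w (t : R), 0 <= t ->
    ((N s w)%:R : R) @[s --> t^'+] --> ((N t w)%:R : R) ;
  poisson_process_independent_increments : forall (n : nat) (t : nat -> R),
    0 <= t 0%N -> (forall i, (i < n)%N -> t i < t i.+1) ->
    mutually_independent P
      (fun i : 'I_n => increment N (t i) (t i.+1)) ;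
  poisson_process_increment_distribution : forall (s t : R) (k : nat),
    0 <= s -> s < t ->
    P [set w | increment N s t w = k] =
    (poisson_pmf (theta * (t - s)) k)%:E }.

Section Trajectory.
Variables (R : realType) (T : Type).

Definition drifted (N : R -> T -> nat) (x t : R) (w : T) : R :=
  x - (N t w)%:R.

(* Extended-real valued, so that it is +oo when X stays positive. *)
Definition first_passage (X : R -> T -> R) (w : T) : \bar R :=
  ereal_inf [set t%:E | t in [set t : R | 0 < t /\ X t w <= 0]].

Definition area (X : R -> T -> R) (w : T) : R :=
  \int[lebesgue_measure]_(t in
    [set t : R | 0 <= t /\ (t%:E <= first_passage X w)%E]) X t w.

(* fine turns a finite passage time into a real number; on the event where the
   passage time is +oo the quotient takes the default value 0. *)
Definition time_average (X : R -> T -> R) (w : T) : R :=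
  area X w / fine (first_passage X w).

End Trajectory.

(* Main.v *)
(* Let n = ceil x be the level at which X becomes nonpositive, T_k the time
   at which N reaches k, so that tau = T_n and the time average of X is
   x - sum_{1 <= k < n} (1 - T_k / T_n).  On a grid of mesh h, the passage occurs
   in a cell ]mh, (m+1)h].  The increments of N over [0, mh] are exchangeable given
   N(mh) and N((m+1)h); reversing time shows that on this event N(jh) and
   N(mh) - N((m-j)h) have the same expectation, so the average of N(0), ..., N(mh)
   has expectation half of that of N(mh).  Except when the cell contains two jumps,
   N(mh) = n - 1.  Letting h tend to 0, dominated convergence gives the
   expectation x - (n - 1) / 2. *)
Require Import Defs.
From HB Require Import structures.
From mathcomp Require Import all_boot all_order all_algebra.
From mathcomp Require Import all_classical all_reals all_analysis.
From mathcomp Require Import measurable_realfun.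
From mathcomp Require Import ring lra zify.

Set Implicit Arguments.
Unset Strict Implicit.
Unset Printing Implicit Defensive.

Import Order.TTheory GRing.Theory Num.Theory.
Import numFieldNormedType.Exports.

Local Open Scope classical_set_scope.
Local Open Scope ring_scope.

(** The time $T_k$ at which a counting path reaches level $k$. The set has the same shape as in
    [first_passage], so that the passage time of the drifted path is one of these times; the value
    is $+\infty$ when the level is never reached. *)
Definition hitting (R : realType) (f : R -> nat) (k : nat) : \bar R :=
  ereal_inf [set t%:E | t in [set t : R | 0 < t /\ (k <= f t)%N]].

(** * Finite sums, and integrals of finite sums *)

Lemma sum_nat_ltn (k m : nat) : (k <= m)%N ->
  (\sum_(i < m) (i < k) = k)%N.
Proof.
move=> km; rewrite -(big_mkord xpredT (fun i => (i < k)%N : nat)).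
rewrite (big_cat_nat (n := k)) //= big_nat_cond (eq_bigr (fun=> 1%N)); last first.
  by move=> i /andP[/andP[_ ->]].
rewrite -big_nat_cond sum_nat_const_nat subn0 muln1 big_nat_cond big1 ?addn0 //.
by move=> i /andP[/andP[ki _] _]; rewrite ltnNge ki.
Qed.

Lemma sum_nat_geq (k m : nat) : (k <= m)%N ->
  (\sum_(i < m) (k <= i) = m - k)%N.
Proof.
move=> km.
have : (\sum_(i < m) (i < k) + \sum_(i < m) (k <= i) = m)%N.
  rewrite -big_split /= -[RHS]card_ord -sum1_card.
  by apply: eq_bigr => i _; rewrite (leqNgt k); case: (_ < _)%N.
by rewrite sum_nat_ltn//; lia.
Qed.

Lemma integrable_sum_EFin d (T : measurableType d) (R : realType)
    (mu : {measure set T -> \bar R}) (D : set T) (I : Type) (s : seq I)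
    (g : I -> T -> R) : measurable D ->
  (forall i, mu.-integrable D (EFin \o g i)) ->
  mu.-integrable D (EFin \o (fun x => \sum_(i <- s) g i x)).
Proof.
move=> mD gi; rewrite (_ : _ \o _ = fun t => (\sum_(k <- s) (EFin \o g k) t)%E).
  exact: integrable_sum.
by apply/funext => t /=; rewrite sumEFin.
Qed.

Lemma Rintegral_sum d (T : measurableType d) (R : realType)
    (mu : {measure set T -> \bar R}) (D : set T) (I : Type) (s : seq I)
    (g : I -> T -> R) : measurable D ->
  (forall i, mu.-integrable D (EFin \o g i)) ->
  \int[mu]_(x in D) (\sum_(i <- s) g i x) = \sum_(i <- s) \int[mu]_(x in D) g i x.
Proof.
move=> mD gi; elim: s => [|i s' IH].
  under eq_Rintegral do rewrite big_nil.
  by rewrite Rintegral_cst// mul0r big_nil.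
under eq_Rintegral do rewrite big_cons.
by rewrite RintegralD ?IH ?big_cons//; exact: integrable_sum_EFin.
Qed.

(** * Hitting times, time averages and grid averages of one deterministic counting path *)

Section counting_path.
Context {R : realType}.
Variable f : R -> nat.
Hypothesis f0 : f 0 = 0%N.
Hypothesis f_mono : forall s t : R, 0 <= s -> s <= t -> (f s <= f t)%N.
Hypothesis f_rc : forall t : R, 0 <= t ->
  ((f s)%:R : R) @[s --> t^'+] --> ((f t)%:R : R).

Lemma hitting_ge0 k : (0 <= hitting f k)%E.
Proof. by apply: le_ereal_inf_tmp => _ [t [t0 _] <-]; rewrite lee_fin ltW. Qed.

(** By right continuity, an integer-valued path that is below $k$ at $t$ stays below $k$ slightly
    longer, so the infimum lies strictly after $t$. Thus the infimum is attained. At $t = 0$,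
    excluded from the defining set, [f 0 = 0] and $k > 0$ decide. *)
Lemma hitting_le k (t : R) : (0 < k)%N -> 0 <= t ->
  (hitting f k <= t%:E)%E = (k <= f t)%N.
Proof.
move=> k0 t0; apply/idP/idP => [|kft]; last first.
  apply: ereal_inf_lbound; exists t => //; split => //.
  rewrite lt_neqAle t0 andbT; apply/eqP => t00.
  by move: kft; rewrite -t00 f0 leqNgt k0.
apply: contraTT; rewrite -ltnNge -ltNge => ftk.
have /cvgrPdist_lt /(_ 1 ltr01)  := f_rc t0.
rewrite near_withinE => /nbhs_ballP[e /= e0 He].
apply: (@lt_le_trans _ _ (t + e / 2)%:E).
  by rewrite lte_fin ltrDl divr_gt0.
apply: le_ereal_inf_tmp => _ [s [s0 kfs] <-]; rewrite lee_fin leNgt; apply/negP => ste.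
have ts : t < s.
  rewrite ltNge; apply/negP => st.
  by move: (leq_trans kfs (f_mono (ltW s0) st)); rewrite leqNgt ftk.
have : `|(f t)%:R - (f s)%:R| < 1 :> R.
  apply: He => //; rewrite /ball /= ltr_distlC; apply/andP; split; lra.
have : (f t).+1%:R <= (f s)%:R :> R by rewrite ler_nat; exact: leq_trans kfs.
by rewrite -natr1 ltr_distlC => h /andP[h1 h2]; lra.
Qed.

Lemma hitting_gt0 k : (0 < k)%N -> (0 < hitting f k)%E.
Proof.
move=> k0; rewrite ltNge hitting_le// f0 -ltnNge //.
Qed.

Lemma le_hitting k l : (k <= l)%N -> (hitting f k <= hitting f l)%E.
Proof.
move=> kl; apply: ereal_inf_le_tmp => _ [t [t0 lt] <-]; exists t => //; split => //.
exact: leq_trans lt.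
Qed.

Lemma hitting_fineK n (T : R) k : hitting f n = T%:E -> (k <= n)%N ->
  ((fine (hitting f k))%:E = hitting f k)%E.
Proof.
move=> hT kn; rewrite fineK// ge0_fin_numE ?hitting_ge0//.
by rewrite (le_lt_trans (le_hitting kn))// hT ltry.
Qed.

(** Before $T_n$ the path is at most $n - 1$, hence it counts which of $T_1, \dots, T_{n-1}$ have
    occurred. This makes both the integral and the grid sums of the path explicit in the hitting
    times. *)
Lemma counting_sum_hitting n (T t : R) : hitting f n = T%:E ->
  0 <= t -> t < T -> (f t)%:R = \sum_(k < n.-1) (fine (hitting f k.+1) <= t)%R%:R :> R.
Proof.
move=> hT t0 tT.
have n0 : (0 < n)%N.
  (* Every positive time reaches level 0, so for $n = 0$ the infimum is at most $t$, against $t <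
     T$. *)
  rewrite lt0n; apply: contraTneq tT => n0; rewrite -leNgt -lee_fin -hT n0.
  have [<-|tn0] := eqVneq 0 t.
    apply/lee_addgt0Pr => e e0; rewrite add0e; apply: ereal_inf_lbound.
    by exists e.
  by apply: ereal_inf_lbound; exists t => //; split => //; rewrite lt_neqAle tn0.
have ftn : (f t <= n.-1)%N.
  by rewrite -ltnS prednK// ltnNge -hitting_le// hT lee_fin -ltNge.
rewrite -{1}(sum_nat_ltn ftn) natr_sum; apply: eq_bigr => k _.
rewrite -lee_fin (hitting_fineK hT) ?hitting_le//.
by have := ltn_ord k; lia.
Qed.

Let mu := @lebesgue_measure R.

(** The indicator of having reached level $k$ integrates to $T - T_k$ over $[0, T]$; dividing by $T$
    gives $1 - T_k / T$. *)
Lemma average_hitting (x : R) n (T : R) : (0 < n)%N -> hitting f n = T%:E ->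
  (\int[mu]_(t in [set t : R | 0 <= t /\ (t%:E <= hitting f n)%E]) (x - (f t)%:R)) / T
  = x - \sum_(k < n.-1) (1 - fine (hitting f k.+1) / T).
Proof.
move=> n0 hT; pose r k := fine (hitting f k).
have T0 : 0 < T by rewrite -lte_fin -hT hitting_gt0.
pose g k (t : R) : R := (r k.+1 <= t)%R%:R.
have rT (k : 'I_n.-1) : 0 <= r k.+1 <= T.
  rewrite -!lee_fin (hitting_fineK hT) ?hitting_ge0 //=; last by have := ltn_ord k; lia.
  by rewrite -hT le_hitting//; have := ltn_ord k; lia.
have -> : [set t : R | 0 <= t /\ (t%:E <= hitting f n)%E] = `[0, T]%classic.
  apply/seteqP; split => t /=; rewrite in_itv/= hT lee_fin; first by case=> -> ->.
  by move=> /andP[].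
have gE k : g k = \1_(`[r k.+1, +oo[%classic).
  by apply/funext => t; rewrite /g indicE; congr (_%:R); rewrite mem_setE in_itv/= andbT.
have Ifin : mu `[0, T]%classic = T%:E.
  by rewrite /mu lebesgue_measure_itv/= lte_fin T0 -EFinD subr0.
have g_int k : mu.-integrable `[0, T]%classic (EFin \o g k).
  rewrite gE; apply: measurable_bounded_integrable => //.
  - by rewrite [X in (X < _)%E]Ifin ltry.
  - exists 1; split => // M M1 t _; apply: le_trans (ltW M1).
    by rewrite /= indicE ger0_norm// lern1 leq_b1.
have c_int (c : R) : mu.-integrable `[0, T]%classic (EFin \o cst c).
  apply: measurable_bounded_integrable => //.
  - by rewrite [X in (X < _)%E]Ifin ltry.
  - exists `|c|; split => // M M1 t _ /=; exact: ltW.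
have S_int : mu.-integrable `[0, T]%classic (EFin \o (fun t => \sum_(k < n.-1) g k t)).
  by apply: integrable_sum_EFin.
pose H t := x - \sum_(k < n.-1) g k t.
have H_int : mu.-integrable `[0, T]%classic (EFin \o H).
  exact: (integrableB _ (c_int x) S_int).
have HTo : mu.-integrable `[0, T[%classic (EFin \o H).
  by apply: integrableS H_int => //; apply: subset_itvl; rewrite bnd_simp.
have eqH t : t \in `[0, T[%classic -> x - (f t)%:R = H t.
  by rewrite mem_setE in_itv/= => /andP[t0 tT]; rewrite /H (counting_sum_hitting hT).
(* The sum of indicators represents the path only for $t < T$, so the null endpoint $T$ is removed
   for the substitution and then restored. *)
rewrite -Rintegral_itv_bndo_bndc; last first.
  by apply: eq_integrable HTo => // t tT; rewrite /= eqH.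
rewrite (@eq_Rintegral _ _ _ mu _ H) //.
rewrite Rintegral_itv_bndo_bndc // RintegralB //; last exact: c_int.
rewrite Rintegral_cst // [X in fine X]Ifin Rintegral_sum //=.
have Ig (k : 'I_n.-1) : \int[mu]_(t in `[0, T]%classic) g k t = T - r k.+1.
  rewrite gE /Rintegral integral_indic//=.
  have /andP[r0 rT'] := rT k.
  rewrite (_ : _ `&` _ = `[r k.+1, T]%classic); last first.
    apply/seteqP; split => t /=; rewrite !in_itv/= ?andbT.
      by case=> -> /andP[_ ->].
    by move=> /andP[rt tT]; split => //; rewrite tT (le_trans r0).
  rewrite /mu lebesgue_measure_itv /= lte_fin; case: ltP => [_ //|Tr].
  by rewrite (_ : r _ = T) ?subrr//; apply/eqP; rewrite eq_le rT'.
under eq_bigr do rewrite Ig.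
rewrite mulrBl mulfK ?gt_eqF// mulr_suml; congr (_ - _).
by apply: eq_bigr => k _; rewrite mulrBl divff ?gt_eqF.
Qed.

(** The index of the first grid point at or after $r$, for $r \ge 0$ and $h > 0$; the absolute value
    only converts to [nat]. *)
Definition grid_ceil (h r : R) : nat := `|Num.ceil (r / h)|%N.

Lemma grid_ceil_le (h r : R) (j : nat) : 0 < h -> 0 <= r ->
  (grid_ceil h r <= j)%N = (r <= j%:R * h).
Proof.
move=> h0 r0; rewrite -ler_pdivrMr// -[in RHS](ceil_le_int _ j%:Z) //.
have : 0 <= Num.ceil (r / h) by rewrite ceil_ge0 (lt_le_trans (ltrN10 R)) // divr_ge0 // ltW.
by move=> c0; rewrite /grid_ceil -lez_nat gez0_abs.
Qed.

Lemma grid_ceil_bounds (h r : R) : 0 < h -> 0 <= r ->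
  r <= (grid_ceil h r)%:R * h <= r + h.
Proof.
move=> h0 r0; rewrite -grid_ceil_le// leqnn /=.
case E : (grid_ceil h r) => [|c]; first by rewrite mul0r addr_ge0// ltW.
rewrite -natr1 mulrDl mul1r lerD2r leNgt; apply/negP => /ltW.
by rewrite -grid_ceil_le// E ltnn.
Qed.

Definition passage_cell (h : R) (n m : nat) : bool :=
  (f (m%:R * h) < n <= f (m.+1%:R * h))%N.

(** A discrete time average: the path is averaged over the grid points up to the start of the
    passage cell. At most one cell contributes, and the value is 0 if the passage does not occur by
    time $Lh$. Only grid values of [f] enter, so expectations reduce to those of increments. *)
Definition grid_average (x h : R) (n L : nat) : R :=
  \sum_(m < L) (passage_cell h n m)%:R *
    (x - (\sum_(j < m.+1) (f (j%:R * h))%:R) / m.+1%:R).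

(** The discrete analogue of [average_hitting], each hitting time being replaced by its grid
    ceiling. *)
Lemma grid_average_hitting (x h : R) n L (T : R) : 0 < h -> (0 < n)%N ->
  hitting f n = T%:E -> T <= L%:R * h ->
  grid_average x h n L =
  x - \sum_(k < n.-1)
        (1 - (grid_ceil h (fine (hitting f k.+1)))%:R / (grid_ceil h T)%:R).
Proof.
move=> h0 n0 hT TL; set c := grid_ceil h T.
have T0 : 0 < T by rewrite -lte_fin -hT hitting_gt0.
have nfE j : (n <= f (j%:R * h))%N = (c <= j)%N.
  by rewrite -hitting_le// ?mulr_ge0 ?(ltW h0)// hT lee_fin grid_ceil_le// ltW.
have c0 : (0 < c)%N by rewrite ltnNge grid_ceil_le ?(ltW T0)// mul0r -ltNge.
have cL : (c.-1 < L)%N by rewrite prednK// grid_ceil_le// ltW.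
(* With $c$ the grid ceiling of $T$, the grid first shows level $n$ at index $c$, so the only
   passage cell starts at index $c - 1$ and the average runs over exactly $c$ points. *)
have cellE m : passage_cell h n m = (m == c.-1).
  by rewrite /passage_cell nfE ltnNge nfE -ltnNge; lia.
rewrite /grid_average (bigD1 (Ordinal cL)) //= cellE eqxx mul1r [X in _ + X]big1 ?addr0; last first.
  by move=> i /negPf ni; rewrite cellE -[_ == _]/(i == Ordinal cL) ni mul0r.
rewrite prednK//; congr (_ - _).
under eq_bigr => j _.
  rewrite (counting_sum_hitting hT) ?mulr_ge0 ?(ltW h0)//; last first.
    by rewrite ltNge -grid_ceil_le// ?(ltW T0)// -ltnNge -/c.
  over.
rewrite exchange_big /= mulr_suml; apply: eq_bigr => k _.
have kn : (k.+1 <= n)%N by have := ltn_ord k; lia.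
have rT : fine (hitting f k.+1) <= T.
  by rewrite -lee_fin (hitting_fineK hT)// -hT le_hitting.
have r0 : 0 <= fine (hitting f k.+1) by rewrite fine_ge0 ?hitting_ge0.
have rc : (grid_ceil h (fine (hitting f k.+1)) <= c)%N.
  by rewrite grid_ceil_le// (le_trans rT)// -grid_ceil_le// ltW.
(* Among these $c$ points, level $k + 1$ has been reached at those whose index is at least the grid
   ceiling of its hitting time. *)
under eq_bigr do rewrite -grid_ceil_le//.
rewrite -natr_sum sum_nat_geq// natrB// mulrBl divff// pnatr_eq0; lia.
Qed.

Lemma grid_average_infinite (x h : R) n L : 0 < h -> (0 < n)%N ->
  hitting f n = +oo%E -> grid_average x h n L = 0.
Proof.
move=> h0 n0 hT; rewrite /grid_average big1 // => m _.
rewrite /passage_cell -(hitting_le n0) ?mulr_ge0 ?(ltW h0)//.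
by rewrite hT leye_eq /= andbF mul0r.
Qed.

(** The sum telescopes: by monotonicity each term is the difference of the indicators of $n \le f$
    at the two ends of its cell, and [f 0 = 0]. *)
Lemma sum_passage_cell (h : R) n L : 0 < h -> (0 < n)%N ->
  \sum_(m < L) (passage_cell h n m)%:R = (n <= f (L%:R * h))%N%:R :> R.
Proof.
move=> h0 n0.
have fS m : (f (m%:R * h) <= f (m.+1%:R * h))%N.
  by rewrite f_mono ?mulr_ge0 ?(ltW h0)// ler_pM2r// ler_nat.
elim: L => [|L IH]; first by rewrite big_ord0 mul0r f0 leqNgt n0.
rewrite big_ord_recr /= IH /passage_cell; have := fS L.
case: (leqP n (f (L%:R * h))) => [a b|a b]; last by rewrite add0r.
by rewrite (leq_trans a b) addr0.
Qed.

(** Every grid value up to the start of the passage cell is below $n$, and at most one cell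
    contributes. Being uniform in [h] and [L], the bound serves as dominating constant. *)
Lemma grid_average_bounded (x h : R) n L : 0 < h -> (0 < n)%N ->
  `|grid_average x h n L| <= `|x| + n%:R.
Proof.
move=> h0 n0; apply: (@le_trans _ _ (\sum_(m < L) (passage_cell h n m)%:R * (`|x| + n%:R))).
  apply: le_trans (ler_norm_sum _ _ _) _; apply: ler_sum => m _.
  rewrite normrM ger0_norm//; case E : passage_cell; last by rewrite !mul0r.
  rewrite !mul1r (le_trans (ler_normB _ _))// lerD2l ger0_norm; last first.
    by rewrite divr_ge0// sumr_ge0.
  rewrite ler_pdivrMr// -natrM -natr_sum ler_nat.
  rewrite -[leqRHS]mulnC -[m.+1 in leqRHS]card_ord -sum_nat_const leq_sum// => j _.
  case/andP : E => fn _; apply: leq_trans (ltnW fn).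
  by rewrite f_mono ?mulr_ge0 ?(ltW h0)// ler_pM2r// ler_nat -ltnS.
rewrite -mulr_suml sum_passage_cell// ler_piMl ?addr_ge0//.
by rewrite lern1 leq_b1.
Qed.
End counting_path.

(* The horizon [horizon p * mesh p = p.+1] tends to infinity, while
   [horizon p * mesh p ^+ 2], which controls the probability of a double jump
   in some cell, tends to 0. *)
Definition mesh (R : realType) (p : nat) : R := (p.+1%:R ^+ 2)^-1.
Definition horizon (p : nat) : nat := (p.+1 ^ 3)%N.

(** * Convergence of the grid averages along one path as the mesh vanishes *)

Section mesh.
Context {R : realType}.

Lemma mesh_gt0 p : 0 < mesh R p.
Proof. by rewrite invr_gt0 exprn_gt0. Qed.

Lemma horizon_mesh p : (horizon p)%:R * mesh R p = p.+1%:R.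
Proof. by rewrite /mesh /horizon natrX exprS mulfK// expf_neq0. Qed.

Lemma horizon_mesh2 p : (horizon p)%:R * mesh R p ^+ 2 = p.+1%:R^-1.
Proof.
by rewrite expr2 mulrA horizon_mesh /mesh expr2 invfM mulrA mulfV// mul1r.
Qed.

Lemma cvg_mesh : mesh R p @[p --> \oo] --> 0.
Proof.
apply: (@squeeze_cvgr _ _ _ _ (fun=> 0) (@harmonic R)).
- near=> p; rewrite ltW ?mesh_gt0//= /harmonic /mesh lef_pV2 ?posrE ?exprn_gt0//.
  by rewrite expr2 ler_peMl// ler1n.
- exact: cvg_cst.
- exact: cvg_harmonic.
Unshelve. all: by end_near. Qed.

Lemma cvg_grid_ceil (r : R) : 0 <= r ->
  (grid_ceil (mesh R p) r)%:R * mesh R p @[p --> \oo] --> r.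
Proof.
move=> r0; apply: (@squeeze_cvgr _ _ _ _ (fun=> r) (fun p => r + mesh R p)).
- by near=> p; apply: grid_ceil_bounds => //; exact: mesh_gt0.
- exact: cvg_cst.
- by rewrite -[X in _ --> X]addr0; apply: cvgD; [exact: cvg_cst|exact: cvg_mesh].
Unshelve. all: by end_near. Qed.

(** The mesh cancels in the quotients of grid ceilings; rescaled by it, each ceiling tends to its
    hitting time, and $T > 0$ allows the division in the limit. *)
Lemma cvg_grid_average (f : R -> nat) (x : R) n (T : R) :
  f 0 = 0%N -> (forall s t : R, 0 <= s -> s <= t -> (f s <= f t)%N) ->
  (forall t : R, 0 <= t -> ((f s)%:R : R) @[s --> t^'+] --> ((f t)%:R : R)) ->
  (0 < n)%N -> hitting f n = T%:E ->
  grid_average f x (mesh R p) n (horizon p) @[p --> \oo] -->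
    x - \sum_(k < n.-1) (1 - fine (hitting f k.+1) / T).
Proof.
move=> f0 f_mono f_rc n0 hT.
have T0 : 0 < T by rewrite -lte_fin -hT hitting_gt0.
pose u p : R := x - \sum_(k < n.-1) (1 -
  ((grid_ceil (mesh R p) (fine (hitting f k.+1)))%:R * mesh R p) /
  ((grid_ceil (mesh R p) T)%:R * mesh R p)).
apply: (@cvg_trans _ (u @ \oo)); last first.
  apply: cvgB; first exact: cvg_cst.
  apply: cvg_big => [|k _]; first exact: add_continuous.
  apply: cvgB; first exact: cvg_cst.
  apply: cvgM; first by apply: cvg_grid_ceil; rewrite fine_ge0 ?hitting_ge0.
  by apply: cvgV; [rewrite gt_eqF|apply: cvg_grid_ceil; rewrite ltW].
apply: near_eq_cvg; near=> p.
(* The explicit formula is available once the horizon, at time $p + 1$, lies beyond the passage. *)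
have Tp : T <= p.+1%:R.
  rewrite (@le_trans _ _ p%:R)// ?ler_nat//.
  near: p; exact: nbhs_infty_ger.
rewrite (grid_average_hitting f0 f_mono f_rc _ _ _ hT) ?mesh_gt0 ?horizon_mesh//.
congr (_ - _); apply: eq_bigr => k _; congr (_ - _).
by rewrite -mulf_div divff ?mulr1// gt_eqF ?mesh_gt0.
Unshelve. all: by end_near. Qed.
End mesh.

(** * Elementary bounds on the Poisson distribution *)

(** Comes from $e^r \ge r^{k+1}/(k+1)!$. Decay of order $1/r$ is enough to make a late passage
    unlikely. *)
Lemma poisson_pmf_le (R : realType) (rate : R) (k : nat) : 0 < rate ->
  poisson_pmf rate k <= k.+1%:R / rate.
Proof.
move=> r0; rewrite /poisson_pmf r0 expRN ler_pdivrMr ?expR_gt0//.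
have := expR_ge1Dxn k (ltW r0); set e := expR rate => he.
have : rate ^+ k.+1 / k.+1`!%:R <= e by apply: le_trans he; rewrite lerDr.
rewrite -(ler_pM2l (_ : 0 < k.+1%:R / rate)) ?divr_gt0//.
apply: le_trans; rewrite le_eqVlt; apply/orP; left; apply/eqP.
rewrite exprS factS natrM; have kf : k`!%:R != 0 :> R by rewrite pnatr_eq0 -lt0n fact_gt0.
have kS : k.+1%:R != 0 :> R by rewrite pnatr_eq0.
have rn0 := lt0r_neq0 r0.
move: kS kf rn0; set a := k.+1%:R; set b := k`!%:R => *.
by field; apply/and3P.
Qed.

(** The sum is $e^{-r}(1 + r)$, and $e^{-r} \ge 1 - r$. *)
Lemma poisson_pmf01_ge (R : realType) (rate : R) : 0 < rate ->
  1 - rate ^+ 2 <= poisson_pmf rate 0 + poisson_pmf rate 1.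
Proof.
move=> r0; rewrite /poisson_pmf r0 expr0 expr1 fact0 factS fact0 muln1 invr1 !mulr1 mul1r.

rewrite (_ : 1 - _ = (1 - rate) + rate * (1 - rate)); last by ring.
have h : 1 - rate <= expR (- rate) by exact: expR_ge1Dx.
by rewrite lerD// ler_pM2l.
Qed.

(** * Exchangeability of Poisson increments and time reversal before the passage *)

Section poisson_process_grid.
Context {R : realType} {d : measure_display} {T : measurableType d}
  {P : probability T R} {theta : R}.
Hypothesis theta_gt0 : 0 < theta.
Variable N : R -> {RV P >-> nat}.
Hypothesis HN : poisson_process theta N.

Let N0 := poisson_process0 HN.
Let N_mono := poisson_process_nondecreasing HN.

Definition crosses (n : nat) (t u : R) (w : T) : bool := (N t w < n <= N u w)%N.

Lemma measurable_comp_count (phi : nat -> R) (s : R) :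
  measurable_fun [set: T] (fun w => phi (N s w)).
Proof.
by apply: (measurableT_comp (f := phi)) => //; exact: measurable_funPT.
Qed.

Lemma measurable_increment (s t : R) : measurable_fun [set: T] (increment N s t).
Proof. by apply: measurable_fun_subn; exact: measurable_funPT. Qed.

Lemma measurable_increment_preimage (s t : R) (A : set nat) :
  measurable (increment N s t @^-1` A).
Proof. by rewrite -[X in measurable X]setTI; exact: measurable_increment. Qed.

Lemma measurable_count_preimage (s : R) (A : set nat) :
  measurable ((N s : T -> nat) @^-1` A).
Proof. by rewrite -[X in measurable X]setTI; exact: measurable_funPT. Qed.

(** The pair $(a, b)$ records the increments over $[0, s]$ and $[s, t]$, while the crossing
    condition sees them only through $a + b$. *)
Definition crossing_event (n : nat) (s t u : R) (a b : nat) : set T :=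
  [set w | [/\ N s w = a, N t w = (a + b)%N & crosses n t u w]].

Lemma measurable_crossing_event n s t u a b :
  measurable (crossing_event n s t u a b).
Proof.
rewrite (_ : crossing_event n s t u a b = (N s : T -> nat) @^-1` [set a] `&`
  ((N t : T -> nat) @^-1` [set c | c = (a + b)%N /\ (c < n)%N] `&`
   (N u : T -> nat) @^-1` [set c | n <= c]%N)).
  by do 2 (apply: measurableI; first exact: measurable_count_preimage);
    exact: measurable_count_preimage.
apply/seteqP; split => w /=; rewrite /crossing_event /= /crosses.
  by case=> -> -> /andP[-> ->].
by case=> -> [[-> ->] ->].
Qed.

Lemma crossing_event_increments n s t u a b : 0 < s -> s < t -> t < u ->
  crossing_event n s t u a b =
  increment N 0 s @^-1` [set a] `&` (increment N s t @^-1` [set b] `&`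
  increment N t u @^-1` [set c | (a + b < n <= a + b + c)%N]).
Proof.
move=> s0 st tu.
have t0 : 0 < t by exact: lt_trans st.
apply/seteqP; split => w; rewrite /crossing_event /crosses /increment /= N0 subn0;
  have st' := N_mono w (ltW s0) (ltW st);
  have tu' := N_mono w (ltW t0) (ltW tu).
  by case=> a1 b1 c1; move: st' tu' c1; rewrite a1 b1 => ? ? ?; lia.
case=> a1 [b1 c1]; move: st' tu' b1 c1; rewrite a1 => h1 h2 h3 h4.
by split=> //; lia.
Qed.

(** Independence of the increments over $[0, s]$, $[s, t]$ and $[t, u]$; the last factor depends on
    $a$ and $b$ through their sum alone. *)
Lemma probability_crossing_event n s t u a b : 0 < s -> s < t -> t < u ->
  P (crossing_event n s t u a b) =
  ((poisson_pmf (theta * s) a)%:E * ((poisson_pmf (theta * (t - s)) b)%:E *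
   P (increment N t u @^-1` [set c | (a + b < n <= a + b + c)%N])))%E.
Proof.
move=> s0 st tu; rewrite crossing_event_increments//.
pose times i : R := nth 0 [:: 0; s; t; u] i.
have tlt i : (i < 3)%N -> times i < times i.+1 by case: i => [|[|[|]]].
pose A (i : 'I_3) : set nat := nth set0
  [:: [set a]; [set b]; [set c | (a + b < n <= a + b + c)%N]] i.
have := poisson_process_independent_increments HN (n := 3) (t := times)
  (lexx 0) tlt (A := A) (fun i => I).
rewrite !big_ord_recl big_ord0 mule1 /A /times /=.
rewrite (poisson_process_increment_distribution HN a (lexx 0) s0).
rewrite (poisson_process_increment_distribution HN b (ltW s0) st) subr0 => <-.
congr (P _); apply/seteqP; split => w /=.
  by move=> [h1 [h2 h3]] [[|[|[|]]] //= i3] _.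
move=> h; split; first exact: (h ord0).
by split; [exact: (h (@Ordinal 3 1 isT) I)|exact: (h (@Ordinal 3 2 isT) I)].
Qed.

(** Exchangeability: interchanging the two lengths together with the two counts permutes the Poisson
    factors and leaves the third factor unchanged. *)
Lemma probability_crossing_event_swap n s r u a b : 0 < s -> 0 < r -> s + r < u ->
  P (crossing_event n s (s + r) u a b) = P (crossing_event n r (s + r) u b a).
Proof.
move=> s0 r0 u0; rewrite !probability_crossing_event ?ltrDl ?ltrDr//.
by rewrite addrK addrC addKr muleCA (addnC b a).
Qed.

(** On a crossing both increments are below $n$, so exactly one pair $(a, b)$ contributes; otherwise
    both sides vanish. Expectations thereby become finite sums. *)
Lemma crossing_count_sum n s t u (phi : nat -> nat -> R) w : 0 <= s -> s <= t ->
  (crosses n t u w)%:R * phi (N s w) (N t w - N s w)%N =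
  \sum_(ab : 'I_n * 'I_n)
    phi ab.1 ab.2 * \1_(crossing_event n s t u ab.1 ab.2) w.
Proof.
move=> s0 st; have stw := N_mono w s0 st.
case E : (crosses n t u w); last first.
  rewrite mul0r big1 // => -[a b] _ /=; rewrite indicE memNset ?mulr0//.
  by case=> _ _; rewrite E.
have tn : (N t w < n)%N by move: E => /andP[].
have sn : (N s w < n)%N by exact: leq_ltn_trans tn.
have dn : (N t w - N s w < n)%N by exact: leq_ltn_trans (leq_subr _ _) tn.
rewrite mul1r (bigD1 (Ordinal sn, Ordinal dn)) //= indicE mem_set; last first.
  by split => //; rewrite subnKC.
rewrite mulr1 big1 ?addr0 // => -[a b] /= nab; rewrite indicE memNset ?mulr0//.
case=> h1 h2 _; move/eqP: nab; apply; congr pair; apply/val_inj => //=.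
by rewrite h2 h1 addKn.
Qed.

Lemma bounded_integrable (g : T -> R) (M : R) : measurable_fun [set: T] g ->
  (forall w, `|g w| <= M) -> P.-integrable [set: T] (EFin \o g).
Proof.
move=> mg gM; apply: measurable_bounded_integrable => //.
  by rewrite -ge0_fin_numE// fin_num_measure.
exists M; split; first exact: num_real.
by move=> M' MM' w _; apply: le_trans (ltW MM').
Qed.

Lemma integrable_scaled_indic (c : R) (A : set T) : measurable A ->
  P.-integrable [set: T] (EFin \o (fun w => c * \1_A w)).
Proof.
move=> mA; apply: (@bounded_integrable _ `|c|).
  by apply: measurable_funM => //; exact: measurable_indic.
by move=> w; rewrite normrM ler_piMr// indicE ger0_norm// lern1 leq_b1.
Qed.

Lemma Rintegral_scaled_indic (c : R) (A : set T) : measurable A ->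
  \int[P]_w (c * \1_A w) = c * fine (P A).
Proof.
move=> mA; rewrite RintegralZl//; last first.
  by have := integrable_scaled_indic 1 mA; under eq_fun do rewrite /= mul1r.
by rewrite /Rintegral integral_indic// setIT.
Qed.

Lemma Rintegral_crossing n s t u (phi : nat -> nat -> R) : 0 <= s -> s <= t ->
  \int[P]_w ((crosses n t u w)%:R * phi (N s w) (N t w - N s w)%N) =
  \sum_(ab : 'I_n * 'I_n)
    phi ab.1 ab.2 * fine (P (crossing_event n s t u ab.1 ab.2)).
Proof.
move=> s0 st; under eq_Rintegral do rewrite crossing_count_sum//.
rewrite Rintegral_sum// => [|ab].
  apply: eq_bigr => ab _.
  by rewrite Rintegral_scaled_indic//; exact: measurable_crossing_event.
by apply: integrable_scaled_indic; exact: measurable_crossing_event.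
Qed.

(** By exchangeability, $N_r$ has the same expectation on the crossing event as the increment of $N$
    over $[s, s+r]$, and adding $N_s$ to that increment gives $N_{s+r}$. *)
Lemma Rintegral_crossing_reversal n s r u : 0 < s -> 0 < r -> s + r < u ->
  \int[P]_w ((crosses n (s + r) u w)%:R * (N s w)%:R) +
  \int[P]_w ((crosses n (s + r) u w)%:R * (N r w)%:R) =
  \int[P]_w ((crosses n (s + r) u w)%:R * (N (s + r) w)%:R).
Proof.
move=> s0 r0 u0.
have sr : s <= s + r by rewrite lerDl ltW.
have rs : r <= s + r by rewrite lerDr ltW.
rewrite (Rintegral_crossing _ _ (fun a b => a%:R) (ltW s0) sr).
rewrite (Rintegral_crossing _ _ (fun a b => a%:R) (ltW r0) rs).
have -> : \int[P]_w ((crosses n (s + r) u w)%:R * (N (s + r) w)%:R) =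
    \int[P]_w ((crosses n (s + r) u w)%:R * ((N s w)%:R + (N (s + r) w - N s w)%:R)).
  by apply: eq_Rintegral => w _; rewrite -natrD subnKC// N_mono// ltW.
rewrite (Rintegral_crossing _ _ (fun a b => a%:R + b%:R) (ltW s0) sr).
(* Interchanging the coordinates of the pair aligns the sum for $N_r$ with the sum for $N_s$, so
   that the swap applies term by term. *)
rewrite [X in _ + X](reindex (fun ab : 'I_n * 'I_n => (ab.2, ab.1))) /=; last first.
  by exists (fun ab => (ab.2, ab.1)) => -[].
rewrite -big_split /=; apply: eq_bigr => -[a b] _ /=.
by rewrite mulrDl probability_crossing_event_swap.
Qed.

Lemma measurable_crosses n t u :
  measurable_fun [set: T] (fun w => (crosses n t u w)%:R : R).
Proof.
rewrite (_ : (fun w => _) = (fun w => (N t w < n)%N%:R * (n <= N u w)%N%:R)).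
  by apply: measurable_funM; [exact: (measurable_comp_count (fun k => (k < n)%N%:R))|
    exact: (measurable_comp_count (fun k => (n <= k)%N%:R))].
by apply/funext => w; rewrite /crosses -natrM mulnb.
Qed.

Lemma integrable_crosses n t u (g : T -> R) (M : R) : measurable_fun [set: T] g ->
  (forall w, crosses n t u w -> `|g w| <= M) ->
  P.-integrable [set: T] (EFin \o (fun w => (crosses n t u w)%:R * g w)).
Proof.
move=> mg gM; apply: (@bounded_integrable _ `|M|).
  by apply: measurable_funM => //; exact: measurable_crosses.
move=> w; case E : (crosses n t u w); last by rewrite mul0r normr0.
by rewrite mul1r (le_trans (gM _ E))// ler_norm.
Qed.

Lemma integrable_crosses_count n s t u : 0 <= s -> s <= t ->
  P.-integrable [set: T] (EFin \o (fun w => (crosses n t u w)%:R * (N s w)%:R)).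
Proof.
move=> s0 st; apply: (@integrable_crosses _ _ _ _ n%:R).
  exact: (measurable_comp_count (fun k => k%:R)).
move=> w /andP[tn _]; rewrite ger0_norm// ler_nat.
by rewrite (leq_trans (N_mono w s0 st))// ltnW.
Qed.

(** Pairing $j$ with $m - j$ as in Gauss's summation: each pair of expectations adds up to that of
    $N_{mh}$, whence the factor $1/2$. *)
Lemma Rintegral_crossing_grid n (h : R) m : 0 < h ->
  \int[P]_w ((crosses n (m%:R * h) (m.+1%:R * h) w)%:R *
     ((\sum_(j < m.+1) (N (j%:R * h) w)%:R) / m.+1%:R)) =
  \int[P]_w ((crosses n (m%:R * h) (m.+1%:R * h) w)%:R * (N (m%:R * h) w)%:R) / 2.
Proof.
move=> h0; pose c j := \int[P]_w ((crosses n (m%:R * h) (m.+1%:R * h) w)%:R *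
  (N (j%:R * h) w)%:R).
have c_int (j : 'I_m.+1) : P.-integrable [set: T] (EFin \o (fun w =>
    (crosses n (m%:R * h) (m.+1%:R * h) w)%:R * (N (j%:R * h) w)%:R)).
  apply: integrable_crosses_count; first by rewrite mulr_ge0// ltW.
  by rewrite ler_pM2r// ler_nat -ltnS.
have c0 : c 0%N = 0.
  rewrite /c mul0r /Rintegral integral0_eq// => w _.
  by rewrite N0 mulr0.
have crev (j : 'I_m.+1) : c j + c (m - j)%N = c m.
  (* The reversal requires two intervals of positive length; at the extreme indices the identity
     reduces to $N_0 = 0$. *)
  have [->|j0] := eqVneq (j : nat) 0%N; first by rewrite c0 subn0 add0r.
  have [->|jm] := eqVneq (j : nat) m; first by rewrite subnn c0 addr0.
  have jm' : (j < m)%N by have := ltn_ord j; lia.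
  have mE : m%:R * h = j%:R * h + (m - j)%:R * h.
    by rewrite -mulrDl -natrD subnKC// ltnW.
  rewrite /c mE; apply: Rintegral_crossing_reversal.
  - by rewrite mulr_gt0// ltr0n lt0n.
  - by rewrite mulr_gt0// ltr0n subn_gt0.
  - by rewrite -mE ltr_pM2r// ltr_nat.
have sumc : \sum_(j < m.+1) c j = m.+1%:R * c m / 2.
  apply: (mulIf (_ : 2 != 0 :> R)) => //; rewrite divfK// mulrDr mulr1.
  rewrite {2}(reindex_inj rev_ord_inj) -big_split /=.
  under eq_bigr do rewrite subSS crev.
  by rewrite sumr_const card_ord mulr_natl.
transitivity ((\sum_(j < m.+1) c j) / m.+1%:R); last first.
  have m0 : m.+1%:R != 0 :> R by rewrite pnatr_eq0.
  by rewrite sumc -/(c m) [_ * c m]mulrC mulrAC mulfK.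
rewrite /c -Rintegral_sum// -RintegralZr//.
  apply: eq_Rintegral => w _.
  by rewrite mulrA mulr_sumr.
exact: integrable_sum_EFin.
Qed.

(** * Error terms: double jumps within a cell and late passage *)

Lemma probability_double_jump (t u : R) : 0 <= t -> t < u ->
  fine (P (increment N t u @^-1` [set c | (2 <= c)%N])) <= (theta * (u - t)) ^+ 2.
Proof.
move=> t0 tu; set lam := theta * (u - t).
have lam0 : 0 < lam by rewrite mulr_gt0// subr_gt0.
pose A := increment N t u @^-1` [set c | (2 <= c)%N].
pose B k := increment N t u @^-1` [set k].
have mA : measurable A by exact: measurable_increment_preimage.
have mB k : measurable (B k) by exact: measurable_increment_preimage.
have PB k : P (B k) = (poisson_pmf lam k)%:E.
  exact: (poisson_process_increment_distribution HN k t0 tu).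
have AE : A = ~` (B 0%N `|` B 1%N).
  apply/seteqP; split => w; rewrite /A /B /=.
    by move=> h [] e; rewrite e in h.
  by case: (increment N t u w) => [|[|c]] //= h; exfalso; apply: h; [left|right].
have PU : P (B 0%N `|` B 1%N) = (poisson_pmf lam 0 + poisson_pmf lam 1)%:E.
  rewrite EFinD -!PB; apply: measureU => //.
  by apply/seteqP; split => w //; rewrite /B /= => -[->].
rewrite -/A AE probability_setC; last exact: measurableU.
rewrite PU -EFinB /= lerBlDl -lerBlDr.
exact: poisson_pmf01_ge.
Qed.

Lemma probability_count_lt (n : nat) (t : R) : 0 < t ->
  fine (P ((N t : T -> nat) @^-1` [set c | (c < n)%N])) <= (n ^ 2)%:R / (theta * t).
Proof.
move=> t0; pose B k := (N t : T -> nat) @^-1` [set k].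
have mB k : measurable (B k) by exact: measurable_count_preimage.
have PB k : P (B k) = (poisson_pmf (theta * t) k)%:E.
  have := poisson_process_increment_distribution HN k (lexx 0) t0.
  rewrite subr0 => <-; congr (P _).
  by apply/seteqP; split => w; rewrite /B /= /increment N0 subn0.
have -> : (N t : T -> nat) @^-1` [set c | (c < n)%N] = \bigcup_(k < n) B k.
  apply/seteqP; split => w /=; first by move=> h; exists (N t w).
  by case=> k /= kn; rewrite /B /= => ->.
rewrite bigcup_mkord.
apply: (@le_trans _ _ (\sum_(k < n) poisson_pmf (theta * t) k)).
  rewrite -lee_fin fineK; last first.
    by rewrite fin_num_measure//; apply: bigsetU_measurable.
  rewrite -sumEFin; under [leRHS]eq_bigr do rewrite -PB.
  exact: Boole_inequality.
apply: (@le_trans _ _ (\sum_(k < n) n%:R / (theta * t))).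
  apply: ler_sum => k _; apply: le_trans (poisson_pmf_le _ _) _.
    by rewrite mulr_gt0.
  by rewrite ler_pM2r ?invr_gt0 ?mulr_gt0// ler_nat.
by rewrite sumr_const card_ord -[leLHS]mulr_natl mulrA -natrM mulnn.
Qed.

(** A crossing that starts below $n - 1$ needs at least two jumps between $t$ and $u$, and the
    deficit never exceeds $n$. *)
Lemma Rintegral_crosses_deficit n (t u : R) : 0 <= t -> t < u ->
  0 <= \int[P]_w ((crosses n t u w)%:R * (n.-1%:R - (N t w)%:R)) <=
    n%:R * (theta * (u - t)) ^+ 2.
Proof.
move=> t0 tu; pose A := increment N t u @^-1` [set c | (2 <= c)%N].
have mA : measurable A by exact: measurable_increment_preimage.
have lt_n w : crosses n t u w -> (N t w <= n.-1)%N by move=> /andP[]; lia.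
apply/andP; split.
  apply: Rintegral_ge0 => w _; case E : (crosses n t u w); last by rewrite mul0r.
  by rewrite mul1r subr_ge0 ler_nat lt_n.
apply: (@le_trans _ _ (\int[P]_w (n%:R * \1_A w))); last first.
  by rewrite Rintegral_scaled_indic// ler_wpM2l// probability_double_jump.
apply: le_Rintegral => //.
- apply: (@integrable_crosses _ _ _ _ n%:R).
    apply: measurable_funB => //.
    exact: (measurable_comp_count (fun k => k%:R)).
  move=> w /lt_n h; rewrite -natrB// ger0_norm// ler_nat; lia.
- exact: integrable_scaled_indic.
- move=> w _; case E : (crosses n t u w); last by rewrite mul0r mulr_ge0.
  have h := lt_n _ E; rewrite mul1r indicE.
  have [<-|ne] := eqVneq (N t w) n.-1; first by rewrite subrr mulr_ge0.
  rewrite mem_set ?mulr1.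
    by rewrite -natrB// ler_nat; lia.
  by move: E; rewrite /A /increment /crosses /= => /andP[]; lia.
Qed.

(** The first error term accounts for a passage after time $Lh$, the second for double jumps in the
    $L$ cells. *)
Lemma Rintegral_grid_average n (x h : R) L : 0 < h -> (0 < n)%N -> (0 < L)%N ->
  `|\int[P]_w grid_average (fun t => N t w) x h n L - (x - n.-1%:R / 2)| <=
  `|x - n.-1%:R / 2| * ((n ^ 2)%:R / (theta * (L%:R * h))) +
  L%:R * (n%:R * (theta * h) ^+ 2) / 2.
Proof.
move=> h0 n0 L0.
pose cr m w : R := (crosses n (m%:R * h) (m.+1%:R * h) w)%:R.
pose e m := \int[P]_w cr m w.
pose dm m := \int[P]_w (cr m w * (n.-1%:R - (N (m%:R * h) w)%:R)).
have cr_int m : P.-integrable [set: T] (EFin \o cr m).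
  apply: (@bounded_integrable _ 1); first exact: measurable_crosses.
  by move=> w; rewrite ger0_norm// lern1 leq_b1.
have Ni m : P.-integrable [set: T] (EFin \o (fun w => cr m w * (N (m%:R * h) w)%:R)).
  by apply: integrable_crosses_count => //; rewrite mulr_ge0// ltW.
have crZ (c : R) m : P.-integrable [set: T] (EFin \o (fun w => cr m w * c)).
  by apply: (@integrable_crosses _ _ _ _ `|c|).
have Si m : P.-integrable [set: T] (EFin \o (fun w => cr m w *
    ((\sum_(j < m.+1) (N (j%:R * h) w)%:R) / m.+1%:R))).
  rewrite (_ : (fun w => _) = (fun w => \sum_(j < m.+1) (m.+1%:R^-1 *
     (cr m w * (N (j%:R * h) w)%:R)))); last first.
    by apply/funext => w; rewrite mulrA mulr_sumr mulr_suml; apply: eq_bigr => j _; rewrite mulrC.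
  apply: integrable_sum_EFin => // j.
  have := @integrableZl _ _ _ P _ measurableT m.+1%:R^-1
    (EFin \o (fun w => cr m w * (N (j%:R * h) w)%:R)); apply.
  apply: integrable_crosses_count; first by rewrite mulr_ge0// ltW.
  by rewrite ler_pM2r// ler_nat -ltnS.
(* Halving the expectation of $N_{mh}$ and writing $N_{mh}$ as $n - 1$ minus the deficit isolates
   the target constant. *)
have Em m : \int[P]_w (cr m w * (x - (\sum_(j < m.+1) (N (j%:R * h) w)%:R) / m.+1%:R))
   = (x - n.-1%:R / 2) * e m + dm m / 2.
  under eq_Rintegral do rewrite mulrBr.
  rewrite RintegralB// Rintegral_crossing_grid//.
  rewrite /dm; under [in RHS]eq_Rintegral do rewrite mulrBr.
  rewrite RintegralB// !RintegralZr//.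
  by rewrite -/(e m) /cr; field.
have -> : \int[P]_w grid_average (fun t => N t w) x h n L =
    (x - n.-1%:R / 2) * (\sum_(m < L) e m) + (\sum_(m < L) dm m) / 2.
  rewrite mulr_sumr mulr_suml -big_split /=.
  rewrite /grid_average Rintegral_sum//; first by apply: eq_bigr => m _; exact: Em.
  move=> m.
  rewrite (_ : (fun w => _) = (fun w => cr m w * x - cr m w *
    ((\sum_(j < m.+1) (N (j%:R * h) w)%:R) / m.+1%:R))); last first.
    by apply/funext => w; rewrite -mulrBr.
  exact: (integrableB _ (crZ x m) (Si m)).
have Lh0 : 0 < L%:R * h by rewrite mulr_gt0// ltr0n.
pose A := (N (L%:R * h) : T -> nat) @^-1` [set c | (c < n)%N].
have mA : measurable A by exact: measurable_count_preimage.
(* The crossing events of the $L$ cells partition the event that level $n$ is reached by time $Lh$,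
   the complement of [A]. *)
have -> : \sum_(m < L) e m = 1 - fine (P A).
  rewrite /e -Rintegral_sum//.
  rewrite (_ : fine (P A) = 1 - fine (P (~` A))); last first.
    by rewrite probability_setC// fineB ?fin_num_measure//=; ring.
  rewrite opprB addrC subrK -[RHS]mul1r -Rintegral_scaled_indic; last exact: measurableC.
  apply: eq_Rintegral => w _; rewrite mul1r.
  have := @sum_passage_cell R (fun t => N t w) (N0 w) (fun s t => @N_mono w s t) h n L h0 n0.
  rewrite /cr => ->; rewrite indicE; congr (_ %:R).
  by rewrite in_setC /A leqNgt; congr (nat_of_bool (~~ _)); apply/idP/idP => [/mem_set|/set_mem].
have dmb (m : 'I_L) : 0 <= dm m <= n%:R * (theta * h) ^+ 2.
  have t0 : 0 <= m%:R * h by rewrite mulr_ge0// ltW.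
  have tu : m%:R * h < m.+1%:R * h by rewrite ltr_pM2r// ltr_nat.
  have := Rintegral_crosses_deficit n t0 tu.
  by rewrite -mulrBl -natrB// subSnn mul1r.
have pA := probability_count_lt n Lh0.
have pA0 : 0 <= fine (P A) by rewrite fine_ge0.
set c := x - _; set D := \sum_(m < L) dm m.
have D0 : 0 <= D by rewrite sumr_ge0// => m _; have /andP[] := dmb m.
have DL : D <= L%:R * (n%:R * (theta * h) ^+ 2).
  rewrite -[L in leRHS]card_ord mulr_natl -sumr_const; apply: ler_sum => m _.
  by have /andP[] := dmb m.
rewrite (_ : _ - c = D / 2 - c * fine (P A)); last by field.
rewrite (le_trans (ler_normB _ _))// addrC normrM (ger0_norm pA0) lerD//.
  by rewrite ler_wpM2l.
by rewrite ger0_norm ?divr_ge0// ler_pM2r.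
Qed.
End poisson_process_grid.

(** * The integer level whose hitting is the passage below zero *)

Section passage_level.
Context {R : realType}.

Definition passage_level (x : R) : nat := `|Num.ceil x|%N.

Lemma passage_level_le (x : R) (k : nat) : 0 < x ->
  (passage_level x <= k)%N = (x <= k%:R).
Proof.
move=> x0; rewrite -[in RHS](ceil_le_int _ k%:Z).
have c0 : 0 <= Num.ceil x by rewrite ceil_ge0 (lt_trans (ltrN10 R)).
by rewrite /passage_level -lez_nat gez0_abs.
Qed.

Lemma passage_level_gt0 (x : R) : 0 < x -> (0 < passage_level x)%N.
Proof. by move=> x0; rewrite ltnNge passage_level_le// -ltNge. Qed.

(** The level is $x$ for an integer $x$ and $[x] + 1$ otherwise. *)
Lemma passage_level_value (x : R) : 0 < x ->
  x - (passage_level x).-1%:R / 2 =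
  if x \is a Num.int then (x + 1) / 2 else x - (Num.floor x)%:~R / 2.
Proof.
move=> x0; have n0 := passage_level_gt0 x0.
have fx : (0 : int) <= Num.floor x by rewrite floor_ge_int ltW.
have nE : (passage_level x)%:Z = Num.floor x + (x \isn't a Num.int).
  by rewrite /passage_level gez0_abs ceil_floor// addr_ge0.
have -> : (passage_level x).-1%:R = (passage_level x)%:R - 1 :> R.
  by rewrite -subn1 natrB.
have -> : (passage_level x)%:R = (Num.floor x)%:~R + (x \isn't a Num.int)%:R :> R.
  by rewrite -[LHS]/((passage_level x)%:Z%:~R) nE intrD; case: (x \isn't a Num.int).
case: ifPn => xint; last by rewrite addrK.
have /eqP -> : (Num.floor x)%:~R == x by rewrite -intrEfloor.
by rewrite /=; field.
Qed.
End passage_level.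

(** * Passage to the limit in the expectation *)

Section time_average.
Context {R : realType} {d : measure_display} {T : measurableType d}
  {P : probability T R} {theta : R}.
Hypothesis theta_gt0 : 0 < theta.
Variable N : R -> {RV P >-> nat}.
Hypothesis HN : poisson_process theta N.
Variable x : R.
Hypothesis x_gt0 : 0 < x.

Let n := passage_level x.
Let n_gt0 : (0 < n)%N := passage_level_gt0 x_gt0.

Lemma first_passage_hitting w :
  first_passage (drifted N x) w = hitting (fun t => N t w) n.
Proof.
congr ereal_inf; congr image; apply/seteqP; split => t /= [t0];
  by rewrite /drifted subr_le0 -passage_level_le.
Qed.

Lemma cvg_grid_time_average w :
  grid_average (fun t => N t w) x (mesh R p) n (horizon p) @[p --> \oo] -->
    time_average (drifted N x) w.
Proof.
have f0 := poisson_process0 HN w.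
have f_mono s t := @poisson_process_nondecreasing _ _ _ _ _ _ HN w s t.
have f_rc t := @poisson_process_right_continuous _ _ _ _ _ _ HN w t.
rewrite /time_average /area first_passage_hitting.
case E : (hitting (fun t => N t w) n) => [S| |].
- have := average_hitting f0 f_mono f_rc x n_gt0 E; rewrite E => A.
  rewrite [X in _ --> X]A.
  exact: (cvg_grid_average f0 f_mono f_rc n_gt0 E).
(* For an infinite passage time, [fine] returns 0, whose inverse is 0; the default time average 0
   agrees with the grid averages, which all vanish. Convergence therefore holds at every outcome. *)
- rewrite /= invr0 mulr0.
  under eq_fun do rewrite (grid_average_infinite f0 f_mono f_rc) ?mesh_gt0//.
  exact: cvg_cst.
- by have := @hitting_ge0 _ (fun t => N t w) n; rewrite E.
Qed.

Lemma measurable_grid_average (h : R) L :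
  measurable_fun [set: T] (fun w => grid_average (fun t => N t w) x h n L).
Proof.
apply: measurable_sum => m; apply: measurable_funM.
  exact: (measurable_crosses N n (m%:R * h) (m.+1%:R * h)).
apply: measurable_funB => //; apply: measurable_funM => //.
by apply: measurable_sum => j; exact: (measurable_comp_count N (fun k => k%:R)).
Qed.

(** Obtained as a pointwise limit of grid averages, each depending on finitely many values of the
    process. *)
Lemma measurable_time_average : measurable_fun [set: T] (time_average (drifted N x)).
Proof.
apply: (@measurable_fun_cvg _ _ _ _
  (fun p w => grid_average (fun t => N t w) x (mesh R p) n (horizon p))).
  by move=> p; exact: measurable_grid_average.
by move=> w _; exact: cvg_grid_time_average.
Qed.

Lemma cvg_Rintegral_grid_average :
  \int[P]_w grid_average (fun t => N t w) x (mesh R p) n (horizon p) @[p --> \oo]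
    --> x - n.-1%:R / 2.
Proof.
set c := x - _.
(* With horizon time $p + 1$ and squared mesh times horizon equal to $1/(p+1)$, both error terms are
   constants times [harmonic p]; [K] adds these constants. *)
pose K := `|c| * ((n ^ 2)%:R / theta) + n%:R * theta ^+ 2 / 2.
have bound p : `|\int[P]_w grid_average (fun t => N t w) x (mesh R p) n (horizon p) - c|
    <= K * harmonic p.
  have L0 : (0 < horizon p)%N by rewrite expn_gt0.
  apply: le_trans (Rintegral_grid_average theta_gt0 HN x (mesh_gt0 p) n_gt0 L0) _.
  rewrite -/c horizon_mesh.
  rewrite (_ : (horizon p)%:R * _ / 2 =
    n%:R * theta ^+ 2 / 2 * ((horizon p)%:R * mesh R p ^+ 2)); last by ring.
  rewrite horizon_mesh2 invfM /harmonic /K mulrDl lerD2r.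
  by rewrite !mulrA.
apply: (@squeeze_cvgr _ _ _ _ (fun p => c - K * harmonic p) (fun p => c + K * harmonic p)).
- by near=> p; rewrite -ler_distl.
- rewrite -[X in _ --> X]subr0 -(mulr0 K); apply: cvgB; first exact: cvg_cst.
  by apply: cvgM; [exact: cvg_cst|exact: cvg_harmonic].
- rewrite -[X in _ --> X]addr0 -(mulr0 K); apply: cvgD; first exact: cvg_cst.
  by apply: cvgM; [exact: cvg_cst|exact: cvg_harmonic].
Unshelve. all: by end_near. Qed.

(** Dominated convergence sends the expectations of the grid averages to that of the time average;
    their limit is already known, and limits are unique. *)
Lemma integrable_expectation_time_average :
  P.-integrable [set: T] (EFin \o time_average (drifted N x)) /\
  ('E_P[time_average (drifted N x)] = (x - n.-1%:R / 2)%:E)%E.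
Proof.
pose g p w := grid_average (fun t => N t w) x (mesh R p) n (horizon p).
have g_bound p w : `|g p w| <= `|x| + n%:R.
  by apply: grid_average_bounded => //; [exact: (poisson_process0 HN)|
    move=> s t; exact: (poisson_process_nondecreasing HN)|exact: mesh_gt0].
have g_cvg : {ae P, forall w, [set: T] w ->
    (EFin \o g p) w @[p --> \oo] --> (EFin \o time_average (drifted N x)) w}.
  apply: aeW => w _; apply: cvg_EFin; first by near=> p.
  exact: cvg_grid_time_average.
have g_dom : {ae P, forall w p, [set: T] w ->
    (`|(EFin \o g p) w| <= cst (`|x| + n%:R)%:E w)%E}.
  by apply: aeW => w p _; rewrite /= lee_fin.
have dom_int : P.-integrable [set: T] (cst (`|x| + n%:R)%:E).
  exact: (@bounded_integrable _ _ _ P (cst (`|x| + n%:R)) `|(`|x| + n%:R)|).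
have [||i _ c] := dominated_convergence measurableT _ _ g_cvg dom_int g_dom.
- by move=> p; apply/measurable_EFinP; exact: measurable_grid_average.
- by apply/measurable_EFinP; exact: measurable_time_average.
split => //; rewrite unlock.
apply: (cvg_unique _ c) => //.
have gi p : (\int[P]_w (EFin \o g p) w = (\int[P]_w g p w)%:E)%E.
  rewrite fineK// integrable_fin_num//; apply: (bounded_integrable (M := `|x| + n%:R)) => //.
  exact: measurable_grid_average.
rewrite /=; under eq_fun do rewrite gi.
apply: cvg_EFin; first by near=> p.
exact: cvg_Rintegral_grid_average.
Unshelve. all: by end_near. Qed.
End time_average.

Theorem mainTheorem7 (R : realType) (d : measure_display)
    (T : measurableType d) (P : probability T R)
    (theta : R) (theta_gt0 : 0 < theta)
    (N : R -> {RV P >-> nat}) (HN : poisson_process theta N)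
    (x : R) (x_gt0 : 0 < x) :
  let X : R -> T -> R := drifted N x in
  let tau : T -> \bar R := first_passage X in
  [/\ P.-integrable [set: T] (EFin \o time_average X),
      ('E_P[time_average X] =
        'E_P[fun w => ((fine (tau w))^-1 *
          \int[lebesgue_measure]_(t in
            [set t : R | 0 <= t /\ (t%:E <= tau w)%E]) X t w)%R])%E &
      ('E_P[time_average X] =
        (if x \is a Num.int then (x + 1) / 2
         else x - (Num.floor x)%:~R / 2)%R%:E)%E].
Proof.
move=> X tau; have [i e] := integrable_expectation_time_average theta_gt0 HN x_gt0.
split => //; last by rewrite e passage_level_value.
by congr expectation; apply/funext => w; rewrite /time_average mulrC.
Qed.
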